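(* Let $Y$ be a real vector space, $F\subseteq Y$, $D\subseteq Y$ with $D\ne Y$, let $H$ be a nonempty proper subset of $Y$ with $H\ne\{0\}$, $a\in Y$ and $k\in Y\setminus\{0\}$. Define $$\Psi:=\operatorname{argmin}_{y\in F\cap\operatorname{dom}\varphi_{a-H,k}}\varphi_{a-H,k}(y).$$ Then: (a) $\operatorname{Eff}(F,D)\cap\Psi\subseteq\operatorname{Eff}(\Psi,D)$. (b) If $H+D\subseteq H$, then $\operatorname{Eff}(F,D)\cap\Psi=\operatorname{Eff}(\Psi,D)$. (c) If $H+D\subseteq H$ and $\Psi=\{y^0\}$, then $y^0\in\operatorname{Eff}(F,D)$. (d) If $H$ is $(-k)$-directionally closed and $H+(D\setminus\{0\})\subseteq\operatorname{core}H$, then $\Psi\subseteq\operatorname{Eff}(F,D)$. (e) $\Psi\subseteq\operatorname{WEff}(F,D)$ holds if $H+D\subseteq H$, or if $H$ is $(-k)$-directionally closed and $H+\operatorname{core}D\subseteq\operatorname{core}H$.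
   Context: For $F,D\subseteq Y$, $\operatorname{Eff}(F,D):=\{y^0\in F\mid F\cap(y^0-D)\subseteq\{y^0\}\}$ and $\operatorname{WEff}(F,D):=\operatorname{Eff}(F,\operatorname{core}D)$. $\operatorname{core}D$ is the algebraic interior of $D$: $d\in\operatorname{core}D$ iff $d\in D$ and for each $v\in Y$ there is $\varepsilon>0$ with $d+sv\in D$ for all $s\in[0,\varepsilon]$. Let $\nu$ be a symbol not in $\mathbb{R}\cup\{-\infty,+\infty\}$ and $\inf\emptyset:=\nu$. For nonempty $A\subseteq Y$ and $k\in Y\setminus\{0\}$, $\varphi_{A,k}(y):=\inf\{t\in\mathbb{R}\mid y\in A+tk\}$ ($-\infty$ if unbounded below) and $\operatorname{dom}\varphi_{A,k}=\{y\in Y\mid\varphi_{A,k}(y)\in\mathbb{R}\cup\{-\infty\}\}$. Here $A=a-H=\{a-h\mid h\in H\}$. Convention for $\operatorname{argmin}$: minimal values are required to be real, so if $\varphi_{a-H,k}$ attains $-\infty$ somewhere on $F\cap\operatorname{dom}\varphi_{a-H,k}$, then $\Psi=\emptyset$; otherwise $\Psi$ is the (possibly empty) set of all minimizers of the real-valued function $\varphi_{a-H,k}$ on $F\cap\operatorname{dom}\varphi_{a-H,k}$. For $v\in Y\setminus\{0\}$, a set $H$ is $v$-directionally closed if for every $y\in Y$: whenever there is a sequence $(t_n)$ of positive reals decreasing to $0$ with $y-t_nv\in H$ for all $n$, then $y\in H$. (So $(-k)$-directionally closed refers to $y+t_nk\in H$.) *)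

(* Defs.v *)
From HB Require Import structures.
From mathcomp Require Import all_boot all_order all_algebra.
From mathcomp Require Import boolp classical_sets reals constructive_ereal ereal.
From mathcomp Require Import topology normedtype sequences.

Set Implicit Arguments.
Unset Strict Implicit.
Unset Printing Implicit Defensive.

Import Order.TTheory GRing.Theory Num.Theory.
Import numFieldNormedType.Exports.

Local Open Scope classical_set_scope.
Local Open Scope ring_scope.

Definition set_sum (V : zmodType) (A B : set V) : set V :=
  [set x + y | x in A & y in B].

Definition Eff (V : zmodType) (F D : set V) : set V :=
  [set y0 | F y0 /\ F `&` [set y0 - d | d in D] `<=` [set y0]].

Definition core (R : realType) (Y : lmodType R) (D : set Y) : set Y :=
  [set d | D d /\ forall v : Y, exists2 e : R, 0 < e &
     forall s : R, 0 <= s <= e -> D (d + s *: v)].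

Definition WEff (R : realType) (Y : lmodType R) (F D : set Y) : set Y :=
  Eff F (core D).

(* Infimum of a set of reals with inf set0 = nu: the symbol nu, which is not
   an extended real, is [None]. *)
Definition inf_nu (R : realType) (S : set R) : option (\bar R) :=
  if `[< S = set0 >] then None else Some (ereal_inf (EFin @` S)).

Definition phi (R : realType) (Y : lmodType R) (A : set Y) (k y : Y) :
    option (\bar R) :=
  inf_nu [set t : R | [set x + t *: k | x in A] y].

Definition dom (R : realType) (Y : Type) (f : Y -> option (\bar R)) : set Y :=
  [set y | (exists r : R, f y = Some r%:E) \/ f y = Some -oo%E].

(* Minimal values must be real: a value -oo anywhere on S makes the argmin
   empty. Intended for S included in dom f. *)
Definition argmin (R : realType) (Y : Type) (f : Y -> option (\bar R))
    (S : set Y) : set Y :=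
  [set y | S y /\ exists2 r : R, f y = Some r%:E &
     forall z, S z -> exists2 s : R, f z = Some s%:E & r <= s].

Definition directionally_closed (R : realType) (Y : lmodType R) (v : Y)
    (H : set Y) : Prop :=
  forall (y : Y) (t : nat -> R),
    (forall n, 0 < t n) -> decreasing_seq t -> t @ \oo --> (0 : R) ->
    (forall n, H (y - t n *: v)) -> H y.

(* Main.v *)
Require Import Defs.
From mathcomp Require Import all_boot all_order all_algebra.
From mathcomp Require Import boolp classical_sets reals constructive_ereal ereal.
From mathcomp Require Import topology normedtype sequences.

Set Implicit Arguments.
Unset Strict Implicit.
Unset Printing Implicit Defensive.

Import Order.TTheory GRing.Theory Num.Theory.
Import numFieldNormedType.Exports.

Local Open Scope classical_set_scope.
Local Open Scope ring_scope.

(** With [a - H] as reference set, [phi y] is the infimum of the set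
    [levels y] of the [t] such that [a + t k - y] lies in [H]. Passing from
    [y] to [y - d] replaces [a + t k - y] by [a + t k - y + d], so the
    hypotheses on [H + D] compare the levels of [y] with those of [y - d];
    a minimizer [y] tolerates no point of [F] with a level below [phi y]
    ([argmin_levels]).

    If [H + D] is included in [H], the levels of [y] are levels of [y - d];
    a point [y - d] of [F] then has a value at most the minimum, hence is
    again a minimizer ([argmin_sub]). So every point of [F] that could
    dominate a minimizer already lies in [Psi], and efficiency of a minimizer
    in [Psi] is efficiency in [F]; a unique minimizer is trivially efficient
    in [Psi]. If moreover [d] is in [core D], then [d - e k] is still in [D]
    for some [e > 0], and the levels of [y] lowered by [e] are levels of
    [y - d], so no such [y - d] lies in [F] ([argmin_core_dominated]): the
    minimizers are weakly efficient.

    If [H] is [(- k)]-directionally closed, the infimum [r] of the levels of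
    [y] is attained ([levels_inf_attained]). When adding [d] sends [H] into
    [core H], the point [a + r k - y + d] can be moved by [- e k] inside [H],
    so [r - e] is a level of [y - d], which again keeps [y - d] out of [F]
    ([argmin_core_shift]). Taking [d] nonzero in [D] gives efficiency, and
    [d] in [core D] weak efficiency. *)

(** * Directional closedness *)

(** It is enough that arbitrarily small steps lead into [H]: a strictly
    decreasing sequence of such steps can then be chosen recursively. *)
Lemma directionally_closed_small (R : realType) (Y : lmodType R) (v : Y)
    (H : set Y) (y : Y) :
  directionally_closed v H ->
  (forall e : R, 0 < e -> exists2 t, 0 < t < e & H (y - t *: v)) -> H y.
Proof.
move=> clH small.
have /choice[g gP] : forall e : R,
    exists t, 0 < e -> 0 < t < e /\ H (y - t *: v).
  move=> e; have [/small[t te Ht]|_] := ltP 0 e; first by exists t.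
  by exists 0.
(* Staying below the harmonic sequence forces convergence to 0. *)
pose t := fix t n := g (if n is m.+1 then Num.min (t m) (harmonic m.+1)
                        else harmonic 0%N).
have harm_gt0 n : 0 < harmonic n :> R by rewrite /harmonic /= invr_gt0.
have arg_gt0 n : 0 < (if n is m.+1 then Num.min (t m) (harmonic m.+1)
                      else harmonic 0%N).
  elim: n => [//|n IHn]; rewrite lt_min harm_gt0 andbT.
  by case: n IHn => [|n] /gP[/andP[]].
have tP n : 0 < t n < (if n is m.+1 then Num.min (t m) (harmonic m.+1)
                       else harmonic 0%N) /\ H (y - t n *: v).
  by case: n (gP _ (arg_gt0 n)).
have t_gt0 n : 0 < t n by have [/andP[]] := tP n.
apply: (clH y t) => //.
- apply/decreasing_seqP => n.
  by have [/andP[_]] := tP n.+1; rewrite lt_min => /andP[].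
- apply: (@squeeze_cvgr _ _ _ _ (fun=> 0) harmonic).
  + apply: nearW => n; rewrite (ltW (t_gt0 n)) /=.
    have [/andP[_]] := tP n; case: n => [/ltW//|n].
    by rewrite lt_min => /andP[_ /ltW].
  + exact: cvg_cst.
  + exact: cvg_harmonic.
- by move=> n; have [] := tP n.
Qed.

(** * Finite infima *)

Lemma inf_nu_fin_lb (R : realType) (S : set R) (r t : R) :
  inf_nu S = Some r%:E -> S t -> r <= t.
Proof.
rewrite /inf_nu; case: ifP => // _ [infS] St.
by rewrite -lee_fin -infS; apply: ereal_inf_lbound; exists t.
Qed.

Lemma inf_nu_fin_adherent (R : realType) (S : set R) (r e : R) :
  inf_nu S = Some r%:E -> 0 < e -> exists2 t, S t & t < r + e.
Proof.
rewrite /inf_nu; case: ifP => // _ [infS] e0.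
have /ereal_inf_lt[_ [t St <-]] : (ereal_inf (EFin @` S) < (r + e)%:E)%E.
  by rewrite infS lte_fin ltrDl.
by rewrite lte_fin; exists t.
Qed.

Lemma inf_nu_le (R : realType) (S : set R) (t : R) :
  S t -> exists2 x : \bar R, inf_nu S = Some x & (x <= t%:E)%E.
Proof.
move=> St; rewrite /inf_nu; case: asboolP => [S0|_]; first by rewrite S0 in St.
by exists (ereal_inf (EFin @` S)) => //; apply: ereal_inf_lbound; exists t.
Qed.

(** * Levels of a point *)

Definition levels (R : realType) (Y : lmodType R) (H : set Y) (a k y : Y) :
    set R :=
  [set t | H (a + t *: k - y)].

Lemma phiE (R : realType) (Y : lmodType R) (H : set Y) (a k y : Y) :
  phi [set a - h | h in H] k y = inf_nu (levels H a k y).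
Proof.
rewrite /phi /levels; congr inf_nu; apply/seteqP; split => t /=.
  move=> [_ [h Hh <-] <-].
  by rewrite opprD addrACA subrr addr0 subKr.
move=> Hy; exists (a - (a + t *: k - y)); first by exists (a + t *: k - y).
by rewrite addrAC subKr.
Qed.

Lemma levels_sub (R : realType) (Y : lmodType R) (H : set Y) (a k y d : Y)
    (t e : R) :
  levels H a k (y - d) (t - e) = H (a + t *: k - y + (d - e *: k)).
Proof.
rewrite /levels /=; congr H.
by rewrite scalerBl opprB (addrA a) addrACA [RHS]addrACA (addrC (- y)).
Qed.

(** Directional closedness makes the infimum of the levels a minimum: levels
    [t > r] arbitrarily close to [r] are points of [H] just beyond
    [a + r k - y] in direction [k]. *)
Lemma levels_inf_attained (R : realType) (Y : lmodType R) (H : set Y)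
    (a k y : Y) (r : R) :
  directionally_closed (- k) H -> inf_nu (levels H a k y) = Some r%:E ->
  levels H a k y r.
Proof.
move=> clH infr; rewrite /levels /=.
have [//|nr] := pselect (H (a + r *: k - y)).
apply: (directionally_closed_small clH) => e e0.
have [t yt tr] := inf_nu_fin_adherent infr e0.
exists (t - r).
  rewrite ltrBlDl tr andbT subr_gt0 lt_neqAle (inf_nu_fin_lb infr yt) andbT.
  by apply/eqP => rt; apply: nr; rewrite rt.
rewrite scalerN opprK addrAC scalerBl -(addrA a) (addrC (r *: k)) subrK.
exact: yt.
Qed.

(** * Minimizers and the points below them *)

Section Minimizers.
Variables (R : realType) (Y : lmodType R) (F H : set Y) (a k : Y).
Let f := phi [set a - h | h in H] k.
Let Psi := argmin f (F `&` dom f).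

(** A level of [z] already puts [z] in the domain, so that [z] competes with
    the minimizer. *)
Lemma argmin_levels (y z : Y) (r t : R) :
  Psi y -> f y = Some r%:E -> F z -> levels H a k z t ->
  dom f z /\ exists2 s : R, f z = Some s%:E & r <= s <= t.
Proof.
move=> [_ [r' fy' minr]] fy Fz zt.
have -> : r = r' by move: fy'; rewrite fy => -[].
have [x infx xt] := inf_nu_le zt.
have fz : f z = Some x by rewrite /f phiE.
have domz : dom f z.
  case: x xt {infx} fz => [s|//|] _ fz; first by left; exists s.
  by right.
split=> //; have [s fzs rs] := minr z (conj Fz domz).
exists s => //; rewrite rs /=.
by move: fz xt; rewrite fzs => -[<-]; rewrite lee_fin.
Qed.

Lemma argmin_sub (D : set Y) (y d : Y) :
  set_sum H D `<=` H -> Psi y -> D d -> F (y - d) -> Psi (y - d).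
Proof.
move=> HD Py Dd Fyd; have [_ [r fy minr]] := Py.
have low t : levels H a k y t -> levels H a k (y - d) t.
  move=> yt; rewrite -(subr0 t) levels_sub scale0r subr0; apply: HD.
  by exists (a + t *: k - y) => //; exists d.
have infr : inf_nu (levels H a k y) = Some r%:E by rewrite -phiE.
have [t0 /low yt0 _] := inf_nu_fin_adherent infr ltr01.
have [domz [s fz /andP[rs _]]] := argmin_levels Py fy Fyd yt0.
(* The competitor's value s is a lower bound of the levels of y. *)
have sr : s <= r.
  apply/ler_addgt0Pr => e e0.
  have [t /low yt tr] := inf_nu_fin_adherent infr e0.
  apply: le_trans (ltW tr); apply: inf_nu_fin_lb yt.
  by rewrite -phiE.
split=> //; exists r => //.
by rewrite fz; congr (Some _%:E); apply/eqP; rewrite eq_le sr rs.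
Qed.

(** Some [d - e k] is still in [D], so all levels of [y] drop by [e]. *)
Lemma argmin_core_dominated (D : set Y) (y d : Y) :
  set_sum H D `<=` H -> Psi y -> core D d -> ~ F (y - d).
Proof.
move=> HD Py [_ /(_ (- k))[e e0 De]] Fyd; have [_ [r fy _]] := Py.
have infr : inf_nu (levels H a k y) = Some r%:E by rewrite -phiE.
have [t yt tr] := inf_nu_fin_adherent infr e0.
have ydt : levels H a k (y - d) (t - e).
  rewrite levels_sub; apply: HD; exists (a + t *: k - y) => //.
  by exists (d - e *: k) => //; rewrite -scalerN; apply: De; rewrite lexx ltW.
have [_ [s _ /andP[rs st]]] := argmin_levels Py fy Fyd ydt.
by move: (le_trans rs st); rewrite lerBrDr leNgt tr.
Qed.

(** The value [r] is a level of [y], and [core H] leaves room to lower the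
    corresponding level of [y - d] below [r]. *)
Lemma argmin_core_shift (y d : Y) :
  directionally_closed (- k) H -> (forall h, H h -> core H (h + d)) ->
  Psi y -> ~ F (y - d).
Proof.
move=> clH Hd Py Fyd; have [_ [r fy _]] := Py.
have yr : levels H a k y r by apply: levels_inf_attained; rewrite -?phiE.
have [_ /(_ (- k))[e e0 He]] := Hd _ yr.
have ydr : levels H a k (y - d) (r - e).
  by rewrite levels_sub addrA -scalerN; apply: He; rewrite lexx ltW.
have [_ [s _ /andP[rs st]]] := argmin_levels Py fy Fyd ydr.
by move: (le_trans rs st); rewrite lerBrDr gerDl leNgt e0.
Qed.

End Minimizers.

Theorem theorem6 (R : realType) (Y : lmodType R) (F D H : set Y) (a k : Y)
    (hD : D <> setT) (hH0 : H !=set0) (hHT : H <> setT) (hH1 : H <> [set 0])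
    (hk : k <> 0) :
  let f := phi [set a - h | h in H] k in
  let Psi := argmin f (F `&` dom f) in
  [/\ Eff F D `&` Psi `<=` Eff Psi D,
      set_sum H D `<=` H -> Eff F D `&` Psi = Eff Psi D,
      forall y0 : Y, set_sum H D `<=` H -> Psi = [set y0] -> Eff F D y0,
      directionally_closed (- k) H -> set_sum H (D `\ 0) `<=` core H ->
        Psi `<=` Eff F D
    & (set_sum H D `<=` H) \/
      (directionally_closed (- k) H /\ set_sum H (core D) `<=` core H) ->
        Psi `<=` WEff F D].
Proof.
move=> f Psi; have PsiF : Psi `<=` F by move=> y [[]].
have partA : Eff F D `&` Psi `<=` Eff Psi D.
  move=> y [[_ effy] Py]; split=> // z [/PsiF Fz zy].
  exact: effy.
have partB : set_sum H D `<=` H -> Eff F D `&` Psi = Eff Psi D.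
  move=> HD; apply/seteqP; split=> // y [Py effy]; split=> //.
  split; first exact: PsiF.
  move=> z [+ [d Dd zE]]; rewrite -{}zE => Fz.
  apply: effy; split; last by exists d.
  exact: (argmin_sub HD Py Dd Fz).
split=> //.
- move=> y0 HD Psi1; have : Eff Psi D y0.
    by rewrite Psi1; split=> // z [].
  by rewrite -partB// => -[].
- move=> clH HD y Py; split; first exact: PsiF.
  move=> z [+ [d Dd zE]]; rewrite -{}zE => Fz.
  have [->|d0] := eqVneq d 0; first exact: subr0.
  exfalso; apply: (argmin_core_shift clH _ Py Fz) => h Hh.
  by apply: HD; exists h => //; exists d => //; split=> //; apply/eqP.
- move=> HD y Py; split; first exact: PsiF.
  move=> z [+ [d Dd zE]]; rewrite -{}zE => Fz.
  exfalso; case: HD => [HD|[clH HD]].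
    exact: (argmin_core_dominated HD Py Dd Fz).
  apply: (argmin_core_shift clH _ Py Fz) => h Hh.
  by apply: HD; exists h => //; exists d.
Qed.
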